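(* The $d$-shift $S=(S_1,\dots,S_d)$ on the symmetric Fock space $\Gamma_s(\mathbb C^d)$ is a maximal commuting operator tuple, i.e. $S$ is a commuting contractive tuple and for every positive integer $n$, $$\Delta_{S^n}=\sum_{k=0}^{n-1}\binom{k+d-1}{d-1}\,\Delta_S .$$
   Context: Fix a positive integer $d$. The full Fock space over $\mathbb C^d$ is $\Gamma(\mathbb C^d)=\mathbb C\oplus\mathbb C^d\oplus(\mathbb C^d)^{\otimes2}\oplus\cdots$ (Hilbert space direct sum). For $k\ge1$ the permutation group $\sigma_k$ acts unitarily on $(\mathbb C^d)^{\otimes k}$ by $U_\pi(x_1\otimes\cdots\otimes x_k)=x_{\pi^{-1}(1)}\otimes\cdots\otimes x_{\pi^{-1}(k)}$, and the symmetric tensor power is the subspace of vectors $\xi\in(\mathbb C^d)^{\otimes k}$ with $U_\pi\xi=\xi$ for all $\pi\in\sigma_k$. The symmetric Fock space $\Gamma_s(\mathbb C^d)\subseteq\Gamma(\mathbb C^d)$ is the direct sum of $\mathbb C$ and all the symmetric tensor powers for $k\ge1$; $P_s$ is the orthogonal projection of $\Gamma(\mathbb C^d)$ onto $\Gamma_s(\mathbb C^d)$. With $e_1,\dots,e_d$ an orthonormal basis of $\mathbb C^d$, the $d$-shift $S=(S_1,\dots,S_d)$ is defined by $S_i\xi=P_s(e_i\otimes\xi)$ for $\xi\in\Gamma_s(\mathbb C^d)$, where $e_i\otimes\omega$ is identified with $e_i$ for the vacuum vector $\omega=(1,0,0,\dots)$. For a contractive $d$-tuple $T=(T_1,\dots,T_d)$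 of bounded operators on a Hilbert space (i.e. $\sum_iT_iT_i^*\le I$), put $P_T(X)=\sum_{i=1}^dT_iXT_i^*$, let $P_T^n$ be its $n$-fold iterate, and define $\Delta_{T^n}=\dim\overline{\mathrm{Range}}\,(I-P_T^n(I))$, with $\Delta_T=\Delta_{T^1}$. A commuting contractive tuple $T$ is called maximal (as a commuting tuple) if $\Delta_{T^n}=\sum_{k=0}^{n-1}\binom{k+d-1}{d-1}\Delta_T$ for every positive integer $n$. *)

(* Defs.v *)
From HB Require Import structures.
From mathcomp Require Import all_boot all_order all_fingroup all_algebra.
From mathcomp Require Import complex ring lra.
From mathcomp Require Import all_classical all_reals all_analysis.

Set Implicit Arguments.
Unset Strict Implicit.
Unset Printing Implicit Defensive.

Import Order.TTheory GRing.Theory Num.Theory.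
Import numFieldNormedType.Exports.

Local Open Scope classical_set_scope.
Local Open Scope ring_scope.

HB.mixin Record NormedModule_isPreHilbert (C : numClosedFieldType) H
    & NormedModule C H := {
  dot : {dot H for @Num.conj C} ;
  dot_normE : forall x : H, dot x x = `|x| ^+ 2
}.

#[short(type="preHilbertType")]
HB.structure Definition PreHilbert (C : numClosedFieldType) :=
  {H of NormedModule C H & NormedModule_isPreHilbert C H}.

#[short(type="hilbertType")]
HB.structure Definition Hilbert (C : numClosedFieldType) :=
  {H of PreHilbert C H & Complete H}.

Notation "''[' u , v ]" := (dot u v) : ring_scope.

Section DotNorm.
Variables (C : numClosedFieldType) (U : lmodType C).
Variable f : {dot U for @Num.conj C}.

Lemma dot_CauchySchwarz x y : `|f x y| ^+ 2 <= f x x * f y y.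
Proof.
have [->|y0] := eqVneq y 0; first by rewrite linear0r normr0 expr0n /= mulr_ge0 ?dnorm_ge0.
have yy : 0 < f y y by rewrite dnorm_gt0.
have yyR : (f y y)^* = f y y by rewrite geC0_conj// ltW.
pose a := f x y / f y y.
have : 0 <= f (x - a *: y) (x - a *: y) by exact: dnorm_ge0.
have -> : f (x - a *: y) (x - a *: y) = f x x - `|f x y| ^+ 2 / f y y.
  rewrite dnormB dnormZ linearZr_LR/= /a rmorphM fmorphV /= yyR.
  rewrite normf_div (gtr0_norm yy) !rmorphM fmorphV/= conjCK yyR.
  rewrite expr_div_n normCK; field; exact: lt0r_neq0.
by rewrite subr_ge0 ler_pdivrMr.
Qed.

Lemma ler_dotnormD x y :
  sqrtC (f (x + y) (x + y)) <= sqrtC (f x x) + sqrtC (f y y).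
Proof.
have fx z := dnorm_ge0 f z.
rewrite -ler_sqr ?nnegrE ?addr_ge0 ?sqrtC_ge0// sqrrD !sqrtCK.
rewrite dnormD addrAC lerD2r lerD2l.
have d2 : f x y + (f x y)^* <= `|f x y| *+ 2.
  apply: le_trans (real_ler_norm _) _.
    by rewrite CrealE rmorphD/= conjCK addrC.
  by rewrite mulr2n (le_trans (ler_normD _ _))// norm_conjC.
apply: le_trans d2 _; rewrite lerMn2r/= -sqrtCM ?nnegrE//.
rewrite -ler_sqr ?nnegrE ?sqrtC_ge0 ?mulr_ge0//.
by rewrite sqrtCK dot_CauchySchwarz.
Qed.
End DotNorm.

HB.factory Record Lmodule_isPreHilbert (C : numClosedFieldType) H
    & GRing.Lmodule C H := {
  form : H -> H -> C ;
  form_linear : forall z, linear_for *%R (form ^~ z) ;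
  form_conj : forall x y, form x y = (form y x)^* ;
  form_gt0 : forall x, x != 0 -> 0 < form x x
}.

HB.builders Context C H & Lmodule_isPreHilbert C H.

Fact formP x : linear_for (Num.conj \; *%R) (form x).
Proof. by move=> a u v; rewrite form_conj form_linear rmorphD rmorphM/= -!form_conj. Qed.

HB.instance Definition _ := bilinear_isBilinear.Build C H H C
  *%R (Num.conj \; *%R) form (form_linear, formP).

Fact form_herm x y : form x y = (-1) ^+ false * (form y x)^*.
Proof. by rewrite expr0 mul1r form_conj. Qed.

HB.instance Definition _ :=
  isHermitianSesquilinear.Build C H false Num.conj form form_herm.

HB.instance Definition _ := isDotProduct.Build C H form form_gt0.

Let pdot : {dot H for @Num.conj C} := form.

Fact normZ (l : C) (x : H) :
  sqrtC (pdot (l *: x) (l *: x)) = `|l| * sqrtC (pdot x x).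
Proof.
by rewrite dnormZ sqrtCM ?nnegrE ?exprn_ge0 ?dnorm_ge0// sqrCK.
Qed.

Fact norm_eq0 (x : H) : sqrtC (pdot x x) = 0 -> x = 0.
Proof. by move/eqP; rewrite sqrt_dnorm_eq0 => /eqP. Qed.

HB.instance Definition _ := Lmodule_isNormed.Build C H
  (ler_dotnormD pdot) normZ norm_eq0.

Fact form_normE (x : H) : pdot x x = `|x| ^+ 2.
Proof. by rewrite sqrtCK. Qed.

HB.instance Definition _ :=
  NormedModule_isPreHilbert.Build C H form_normE.
HB.end.

Lemma dotC (C : numClosedFieldType) (H : preHilbertType C) (x y : H) :
  '[x, y] = '[y, x]^*.
Proof. by rewrite hermC expr0 mul1r. Qed.

Definition sqnorm (R : realType) (H : preHilbertType R[i]) (x : H) : R :=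
  complex.Re '[x, x].

Section SqNorm.
Variables (R : realType) (H : preHilbertType R[i]).
Implicit Types x y : H.

Lemma sqnormE x : '[x, x] = (sqnorm x)%:C%C.
Proof.
have := dnorm_ge0 (@dot R[i] H) x.
by rewrite /sqnorm; case: '[x, x] => a b; rewrite lecE/= => /andP[/eqP-> _].
Qed.

Lemma sqnorm_ge0 x : 0 <= sqnorm x.
Proof. by rewrite -ler0c -sqnormE dnorm_ge0. Qed.

Lemma sqnorm0 : sqnorm (0 : H) = 0.
Proof. by rewrite /sqnorm linear0r. Qed.

Lemma sqnorm_eq0 x : sqnorm x = 0 -> x = 0.
Proof.
move=> x0; apply/eqP; rewrite -(dnorm_eq0 (@dot R[i] H)).
by rewrite sqnormE x0.
Qed.

Lemma sqnormDE x y :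
  sqnorm (x + y) = sqnorm x + sqnorm y + complex.Re '[x, y] *+ 2.
Proof.
rewrite /sqnorm dnormD; case: '[x, x] '[y, y] '[x, y] => [a b] [c e] [g h] /=.
by rewrite mulr2n.
Qed.

Lemma sqnormZ (a : R[i]) x :
  sqnorm (a *: x) = (complex.Re a ^+ 2 + complex.Im a ^+ 2) * sqnorm x.
Proof.
rewrite [LHS]/sqnorm dnormZ sqnormE -add_Re2_Im2.
by case: a => a b /=; rewrite mulr0 subr0.
Qed.

Lemma sqnormN x : sqnorm (- x) = sqnorm x.
Proof. by rewrite -scaleN1r sqnormZ /=; ring. Qed.

Lemma sqnormD_le x y : sqnorm (x + y) <= 2 * sqnorm x + 2 * sqnorm y.
Proof.
have := sqnorm_ge0 (x - y); rewrite !sqnormDE sqnormN linearNr raddfN/=.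
lra.
Qed.

Lemma Re_dot_le x y : `|complex.Re '[x, y]| <= sqnorm x + sqnorm y.
Proof.
have := sqnorm_ge0 (x - y); have := sqnorm_ge0 (x + y).
rewrite !sqnormDE sqnormN linearNr raddfN/= ler_norml => h1 h2.
have := sqnorm_ge0 x; have := sqnorm_ge0 y; move=> *; apply/andP; split; lra.
Qed.

Lemma Im_dot_le x y : `|complex.Im '[x, y]| <= sqnorm x + sqnorm y.
Proof.
have := Re_dot_le x ('i%C *: y); rewrite sqnormZ linearZr_LR/=.
case: '[x, y] => a b /=.
have -> : 0 * a - - (1) * b = b :> R by ring.
by have -> : (0 ^+ 2 + 1 ^+ 2) * sqnorm y = sqnorm y by ring.
Qed.

Lemma norm_lt_sqnorm x (r : R) : 0 < r -> (`|x| < r%:C%C) = (sqnorm x < r ^+ 2).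
Proof.
move=> r0; rewrite -(@ltr_pXn2r _ 2)// ?nnegrE ?ler0c ?(ltW r0)// -dot_normE sqnormE.
by rewrite -rmorphXn/= ltcR.
Qed.

Lemma gt0_realC (e : R[i]) : 0 < e -> exists2 r : R, 0 < r & e = r%:C%C.
Proof.
by case: e => a b; rewrite ltcE/= => /andP[/eqP-> a0]; exists a.
Qed.

Lemma cauchy_sqnorm (F : set_system H) : ProperFilter F -> cauchy F ->
  forall r : R, 0 < r -> exists2 A : set H, F A &
    forall x y, A x -> A y -> sqnorm (x - y) < r.
Proof.
move=> FF /cauchy_ballP Fc r r0.
have s0 : 0 < Num.sqrt r by rewrite sqrtr_gt0.
have [|[A B] /= [FA FB] AB] := Fc (Num.sqrt r)%:C%C; first by rewrite ltcR.
exists (A `&` B); first exact: filterI.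
move=> x y [Ax _] [_ By]; have := AB (x, y) (conj Ax By).
by rewrite /= -ball_normE /ball_/= norm_lt_sqnorm// sqr_sqrtr// ltW.
Qed.

Lemma cvg_sqnorm (F : set_system H) (FF : ProperFilter F) (l : H) :
  (forall r : R, 0 < r -> \forall x \near F, sqnorm (l - x) < r) -> F --> l.
Proof.
move=> h; apply/cvgrPdist_lt => e /gt0_realC[r r0 ->].
have : \forall x \near F, sqnorm (l - x) < r ^+ 2 by apply: h; rewrite exprn_gt0.
by apply: filterS => x; rewrite -norm_lt_sqnorm.
Qed.

Lemma cvg_sqnormP (F : set_system H) (FF : ProperFilter F) (l : H) :
  F --> l -> forall r : R, 0 < r -> \forall x \near F, sqnorm (l - x) < r.
Proof.
move=> /cvgrPdist_lt h r r0.
have s0 : 0 < Num.sqrt r by rewrite sqrtr_gt0.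
have : \forall x \near F, `|l - x| < (Num.sqrt r)%:C%C by apply: h; rewrite ltcR.
by apply: filterS => x; rewrite norm_lt_sqnorm// sqr_sqrtr// ltW.
Qed.

Lemma cauchy_coord (F : set_system H) (phi : H -> R) : ProperFilter F ->
  cauchy F -> (forall x y, (phi x - phi y) ^+ 2 <= sqnorm (x - y)) ->
  cvg (phi @ F).
Proof.
move=> FF Fc phiL; apply: R_complete; apply/cauchy_ballP => e e0.
have e20 : 0 < e ^+ 2 by rewrite exprn_gt0.
have [A FA hA] := cauchy_sqnorm FF Fc e20.
exists (phi @` A, phi @` A) => /=.
  have FA2 : F (phi @^-1` (phi @` A)) by apply: filterS FA => x Ax; exists x.
  by split.
move=> [a b] /= [[x Ax <-] [y Ay <-]].
rewrite -ball_normE /ball_/= -(@ltr_pXn2r _ 2)// ?nnegrE 1?ltW//.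
by rewrite real_normK ?num_real// (le_lt_trans (phiL _ _))// hA.
Qed.
End SqNorm.

Lemma cvg_rsum (R : realType) T (F : set_system T) (FF : Filter F) I (r : seq I)
    (f : I -> T -> R) (a : I -> R) : (forall i, f i @ F --> a i) ->
  (fun t => \sum_(i <- r) f i t) @ F --> \sum_(i <- r) a i.
Proof.
move=> fa; elim: r => [|i r IHr].
  by under eq_fun do rewrite big_nil; rewrite big_nil; exact: cvg_cst.
under eq_fun do rewrite big_cons.
by rewrite big_cons; apply: cvgD; [exact: fa|exact: IHr].
Qed.

(* The tensor power (C^d)^{(x) k}, in the orthonormal basis of the elementary
   tensors of vectors of the standard basis (u_j) of C^d: f stands for
   \sum_w f(w) u_{w_1} (x) ... (x) u_{w_k}. For k = 0 there is one (empty) word and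
   this is C. *)
Definition tensor_power (R : realType) (d k : nat) : Type :=
  {ffun k.-tuple 'I_d -> R[i]}.

Section TensorPower.
Variables (R : realType) (d k : nat).
Local Notation V := (tensor_power R d k).

HB.instance Definition _ := GRing.Lmodule.copy V {ffun k.-tuple 'I_d -> R[i]}.

Definition tensor_dot (f g : V) : R[i] := \sum_w f w * (g w)^*.

Fact tensor_dot_linear z : linear_for *%R (tensor_dot ^~ z).
Proof.
move=> a u v; rewrite /tensor_dot mulr_sumr -big_split/=.
by apply: eq_bigr => w _; rewrite !ffunE mulrDl mulrA.
Qed.

Fact tensor_dot_conj f g : tensor_dot f g = (tensor_dot g f)^*.
Proof.
rewrite /tensor_dot rmorph_sum/=; apply: eq_bigr => w _.
by rewrite rmorphM/= conjCK mulrC.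
Qed.

Fact tensor_dot_gt0 f : f != 0 -> 0 < tensor_dot f f.
Proof.
move=> f0; rewrite /tensor_dot lt0r; apply/andP; split; last first.
  by apply: sumr_ge0 => w _; rewrite mul_conjC_ge0.
apply: contra f0; rewrite psumr_eq0; last by move=> w _; exact: mul_conjC_ge0.
move=> /allP f0; apply/eqP/ffunP => w; rewrite ffunE.
by have := f0 w (mem_index_enum _); rewrite /= mul_conjC_eq0 => /eqP.
Qed.

HB.instance Definition _ := Lmodule_isPreHilbert.Build R[i] V
  tensor_dot_linear tensor_dot_conj tensor_dot_gt0.

Lemma tensor_dotE (f g : V) : '[f, g] = \sum_w f w * (g w)^*.
Proof. by []. Qed.

Lemma sqnorm_tensor (f : V) :
  sqnorm f = \sum_w (complex.Re (f w) ^+ 2 + complex.Im (f w) ^+ 2).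
Proof.
apply: complexI; rewrite -sqnormE tensor_dotE rmorph_sum.
by apply: eq_bigr => w _; rewrite -normCK -add_Re2_Im2.
Qed.

Lemma le_coord_tensor (f g : V) w :
  (complex.Re (f w) - complex.Re (g w)) ^+ 2 +
  (complex.Im (f w) - complex.Im (g w)) ^+ 2 <= sqnorm (f - g).
Proof.
have -> : complex.Re (f w) - complex.Re (g w) = complex.Re ((f - g) w).
  by rewrite !ffunE; case: (f w) (g w) => [a b] [c e].
have -> : complex.Im (f w) - complex.Im (g w) = complex.Im ((f - g) w).
  by rewrite !ffunE; case: (f w) (g w) => [a b] [c e].
rewrite sqnorm_tensor (bigD1 w)//= lerDl sumr_ge0// => v _.
by rewrite addr_ge0// sqr_ge0.
Qed.

Fact tensor_complete (F : set_system V) : ProperFilter F -> cauchy F -> cvg F.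
Proof.
move=> FF Fc.
have cRe w : cvg ((fun f : V => complex.Re (f w)) @ F).
  apply: cauchy_coord => // f g; apply: le_trans (le_coord_tensor f g w).
  by rewrite lerDl sqr_ge0.
have cIm w : cvg ((fun f : V => complex.Im (f w)) @ F).
  apply: cauchy_coord => // f g; apply: le_trans (le_coord_tensor f g w).
  by rewrite lerDr sqr_ge0.
pose l : V := [ffun w => (lim ((fun f : V => complex.Re (f w)) @ F) +i*
                  lim ((fun f : V => complex.Im (f w)) @ F))%C].
apply/cvg_ex; exists l; apply: cvg_sqnorm => r r0.
suff : (fun f => sqnorm (l - f)) @ F --> (0 : R).
  move/cvgrPdist_lt => /(_ r r0); apply: filterS => f.
  by rewrite sub0r normrN ger0_norm// sqnorm_ge0.
have -> : (fun f : V => sqnorm (l - f)) = (fun f => \sum_w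
   ((complex.Re (l w) - complex.Re (f w)) ^+ 2 +
    (complex.Im (l w) - complex.Im (f w)) ^+ 2)).
  apply/funext => f; rewrite sqnorm_tensor; apply: eq_bigr => w _.
  by rewrite !ffunE /=; case: (f w).
have -> : nbhs (0 : R) = nbhs (\sum_(w : k.-tuple 'I_d) (0 : R)) by rewrite big1.
apply: cvg_rsum => w.
have sub0 (phi : V -> R) : cvg (phi @ F) ->
    (fun f : V => (lim (phi @ F) - phi f) ^+ 2) @ F --> (0 : R).
  move=> cphi; have -> : nbhs (0 : R) = nbhs ((lim (phi @ F) - lim (phi @ F)) ^+ 2).
    by rewrite subrr expr0n.
  by apply: cvgM; (apply: cvgB; [exact: cvg_cst|exact: cphi]).
rewrite ffunE /= -[X in _ --> X](addr0 (0 : R)).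
by apply: cvgD; apply: sub0.
Qed.

HB.instance Definition _ := Uniform_isComplete.Build V tensor_complete.
End TensorPower.

Section HilbertSum.
Variables (R : realType) (H : nat -> hilbertType R[i]).

Definition square_summable (x : forall k, H k) : Prop :=
  cvgn (series (fun k => sqnorm (x k))).

(* the Hilbert space direct sum of the H k *)
Record hilbert_sum : Type := HilbertSum {
  component :> forall k, H k ;
  hilbert_sumP : square_summable component }.

Local Notation V := hilbert_sum.

Lemma hilbert_sum_ext (x y : V) : (forall k, x k = y k) -> x = y.
Proof.
case: x y => [x xP] [y yP] /= xy.
have {}xy : x = y by exact: functional_extensionality_dep.
by rewrite {}xy in xP *; congr HilbertSum; exact: Prop_irrelevance.
Qed.

Fact hs0_subproof : square_summable (fun k => 0 : H k).
Proof.
rewrite /square_summable; have -> : (fun k => sqnorm (0 : H k)) = fun=> 0.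
  by apply/funext => k; rewrite sqnorm0.
have -> : series (fun=> 0 : R) = fun=> 0.
  by apply/funext => n; rewrite /series /= big1.
exact: is_cvg_cst.
Qed.

Fact hsD_subproof (x y : V) : square_summable (fun k => x k + y k).
Proof.
apply: (@series_le_cvg _ _
    ((2 : R) *: ((fun k => sqnorm (x k)) + (fun k => sqnorm (y k))))).
- by move=> k; exact: sqnorm_ge0.
- by move=> k; rewrite mulr_ge0// addr_ge0// sqnorm_ge0.
- by move=> k; rewrite (le_trans (sqnormD_le _ _))// -mulrDr.
- by apply: is_cvg_seriesZ; apply: is_cvg_seriesD; exact: hilbert_sumP.
Qed.

Fact hsZ_subproof (a : R[i]) (x : V) : square_summable (fun k => a *: x k).
Proof.
have -> : square_summable (fun k => a *: x k) =
    cvgn (series ((complex.Re a ^+ 2 + complex.Im a ^+ 2) *: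
                  (fun k => sqnorm (x k)))).
  by congr (cvgn (series _)); apply/funext => k; rewrite sqnormZ.
by apply: is_cvg_seriesZ; exact: hilbert_sumP.
Qed.

Definition hs0 : V := @HilbertSum _ (@hs0_subproof).
Definition hsD (x y : V) : V := @HilbertSum _ (@hsD_subproof x y).
Definition hsZ (a : R[i]) (x : V) : V := @HilbertSum _ (@hsZ_subproof a x).
Definition hsN (x : V) : V := hsZ (- 1) x.

HB.instance Definition _ := gen_eqMixin V.
HB.instance Definition _ := gen_choiceMixin V.

Fact hsDA : associative hsD.
Proof. by move=> x y z; apply: hilbert_sum_ext => k /=; rewrite addrA. Qed.
Fact hsDC : commutative hsD.
Proof. by move=> x y; apply: hilbert_sum_ext => k /=; rewrite addrC. Qed.
Fact hs0D : left_id hs0 hsD.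
Proof. by move=> x; apply: hilbert_sum_ext => k /=; rewrite add0r. Qed.
Fact hsND : left_inverse hs0 hsN hsD.
Proof.
by move=> x; apply: hilbert_sum_ext => k /=; rewrite scaleN1r addNr.
Qed.

HB.instance Definition _ := GRing.isZmodule.Build V hsDA hsDC hs0D hsND.

Fact hsZA a b x : hsZ a (hsZ b x) = hsZ (a * b) x.
Proof. by apply: hilbert_sum_ext => k /=; rewrite scalerA. Qed.
Fact hs1Z : left_id 1 hsZ.
Proof. by move=> x; apply: hilbert_sum_ext => k /=; rewrite scale1r. Qed.
Fact hsZDr : right_distributive hsZ +%R.
Proof. by move=> a x y; apply: hilbert_sum_ext => k /=; rewrite scalerDr. Qed.
Fact hsZDl x : {morph hsZ ^~ x : a b / a + b}.
Proof. by move=> a b; apply: hilbert_sum_ext => k /=; rewrite scalerDl. Qed.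

HB.instance Definition _ :=
  GRing.Zmodule_isLmodule.Build R[i] V hsZA hs1Z hsZDr hsZDl.

Lemma hilbert_sumD (x y : V) k : (x + y) k = x k + y k. Proof. by []. Qed.
Lemma hilbert_sumZ a (x : V) k : (a *: x) k = a *: x k. Proof. by []. Qed.
Lemma hilbert_sumB (x y : V) k : (x - y) k = x k - y k.
Proof. by rewrite -[- y k]scaleN1r. Qed.

(* the series \sum_k '[x k, y k], summed on its real and imaginary parts *)
Definition hilbert_sum_dot (x y : V) : R[i] :=
  (limn (series (fun k => complex.Re '[x k, y k])) +i*
   limn (series (fun k => complex.Im '[x k, y k])))%C.

Lemma is_cvg_Re_dot (x y : V) :
  cvgn (series (fun k => complex.Re '[x k, y k])).
Proof.
apply: normed_cvg; apply: (@series_le_cvg _ _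
    ((fun k => sqnorm (x k)) + (fun k => sqnorm (y k)))).
- by move=> k; exact: normr_ge0.
- by move=> k; rewrite addr_ge0// sqnorm_ge0.
- by move=> k; exact: Re_dot_le.
- by apply: is_cvg_seriesD; exact: hilbert_sumP.
Qed.

Lemma is_cvg_Im_dot (x y : V) :
  cvgn (series (fun k => complex.Im '[x k, y k])).
Proof.
apply: normed_cvg; apply: (@series_le_cvg _ _
    ((fun k => sqnorm (x k)) + (fun k => sqnorm (y k)))).
- by move=> k; exact: normr_ge0.
- by move=> k; rewrite addr_ge0// sqnorm_ge0.
- by move=> k; exact: Im_dot_le.
- by apply: is_cvg_seriesD; exact: hilbert_sumP.
Qed.

Fact hilbert_sum_dot_linear z : linear_for *%R (hilbert_sum_dot ^~ z).
Proof.
move=> [a b] u v; rewrite /hilbert_sum_dot.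
have -> : (fun k => complex.Re '[((a +i* b)%C *: u + v) k, z k]) =
    (a *: (fun k => complex.Re '[u k, z k])
     - b *: (fun k => complex.Im '[u k, z k]))
     + (fun k => complex.Re '[v k, z k]).
  apply/funext => k; rewrite hilbert_sumD hilbert_sumZ linearDl linearZl_LR/=.
  rewrite !fctE.
  by case: '[u k, z k] '[v k, z k] => [? ?] [? ?].
have -> : (fun k => complex.Im '[((a +i* b)%C *: u + v) k, z k]) =
    (a *: (fun k => complex.Im '[u k, z k])
     + b *: (fun k => complex.Re '[u k, z k]))
     + (fun k => complex.Im '[v k, z k]).
  apply/funext => k; rewrite hilbert_sumD hilbert_sumZ linearDl linearZl_LR/=.
  rewrite !fctE.
  by case: '[u k, z k] '[v k, z k] => [? ?] [? ?].
have cRu := @is_cvg_Re_dot u z; have cIu := @is_cvg_Im_dot u z.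
have cRv := @is_cvg_Re_dot v z; have cIv := @is_cvg_Im_dot v z.
set ru := (fun k => complex.Re '[u k, z k]) in cRu *.
set iu := (fun k => complex.Im '[u k, z k]) in cIu *.
set rv := (fun k => complex.Re '[v k, z k]) in cRv *.
set iv := (fun k => complex.Im '[v k, z k]) in cIv *.
have cau := @is_cvg_seriesZ _ ru a cRu; have cbu := @is_cvg_seriesZ _ iu b cIu.
have cai := @is_cvg_seriesZ _ iu a cIu; have cbr := @is_cvg_seriesZ _ ru b cRu.
rewrite (lim_seriesD (is_cvg_seriesB cau cbu) cRv).
rewrite (lim_seriesB cau cbu) (lim_seriesD (is_cvg_seriesD cai cbr) cIv).
rewrite (lim_seriesD cai cbr) (lim_seriesZ a cRu) (lim_seriesZ b cIu).
rewrite (lim_seriesZ a cIu) (lim_seriesZ b cRu).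
by move: (limn (series ru)) (limn (series iu)) (limn (series rv))
  (limn (series iv)).
Qed.

Fact hilbert_sum_dot_conj x y : hilbert_sum_dot x y = (hilbert_sum_dot y x)^*.
Proof.
rewrite /hilbert_sum_dot; apply/eqP; rewrite eq_complex /=; apply/andP; split.
  apply/eqP; congr (limn (series _)); apply/funext => k.
  by rewrite dotC; case: '[y k, x k].
rewrite -lim_seriesN; last exact: is_cvg_Im_dot.
apply/eqP; congr (limn (series _)); apply/funext => k.
by rewrite dotC !fctE; case: '[y k, x k].
Qed.

Lemma hilbert_sum_dotxx x :
  hilbert_sum_dot x x = (limn (series (fun k => sqnorm (x k))))%:C%C.
Proof.
rewrite /hilbert_sum_dot; congr (_ +i* _)%C.
have -> : series (fun k => complex.Im '[x k, x k]) = fun=> 0.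
  by apply/funext => n; rewrite /series/= big1// => k _; rewrite sqnormE.
exact: lim_cst.
Qed.

Lemma sqnorm_partial_le (x : V) n :
  \sum_(0 <= k < n) sqnorm (x k) <= limn (series (fun k => sqnorm (x k))).
Proof.
apply: (nondecreasing_cvgn_le _ (@hilbert_sumP x)).
by apply: nondecreasing_series => k _ _; exact: sqnorm_ge0.
Qed.

Fact hilbert_sum_dot_gt0 x : x != 0 -> 0 < hilbert_sum_dot x x.
Proof.
move=> x0; rewrite hilbert_sum_dotxx ltcR lt0r; apply/andP; split; last first.
  by rewrite (le_trans _ (sqnorm_partial_le x 0))// big_geq.
apply: contra x0 => /eqP lim0; apply/eqP/hilbert_sum_ext => k.
apply: sqnorm_eq0; apply/eqP; rewrite eq_le sqnorm_ge0 andbT -lim0.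
apply: le_trans (sqnorm_partial_le x k.+1).
by rewrite big_nat_recr//= lerDr sumr_ge0// => i _; exact: sqnorm_ge0.
Qed.

HB.instance Definition _ := Lmodule_isPreHilbert.Build R[i] V
  hilbert_sum_dot_linear hilbert_sum_dot_conj hilbert_sum_dot_gt0.

Lemma hilbert_sum_dotE (x y : V) : '[x, y] =
  (limn (series (fun k => complex.Re '[x k, y k])) +i*
   limn (series (fun k => complex.Im '[x k, y k])))%C.
Proof. by []. Qed.

Lemma sqnorm_hilbert_sum (x : V) :
  sqnorm x = limn (series (fun k => sqnorm (x k))).
Proof.
have := hilbert_sum_dotxx x.
by rewrite -[hilbert_sum_dot x x]/('[x, x]) sqnormE => /complexI.
Qed.

Lemma sqnorm_sum_le (x : V) n : \sum_(0 <= k < n) sqnorm (x k) <= sqnorm x.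
Proof. by rewrite sqnorm_hilbert_sum; exact: sqnorm_partial_le. Qed.

Lemma sqnorm_component_le (x : V) k : sqnorm (x k) <= sqnorm x.
Proof.
apply: le_trans (sqnorm_sum_le x k.+1).
by rewrite big_nat_recr//= lerDr sumr_ge0// => i _; exact: sqnorm_ge0.
Qed.

Lemma bounded_square_summable (x : forall k, H k) (M : R) :
  (forall n, \sum_(0 <= k < n) sqnorm (x k) <= M) -> square_summable x.
Proof.
move=> xM; apply: nondecreasing_is_cvgn.
  by apply: nondecreasing_series => k _ _; exact: sqnorm_ge0.
by exists M => _ [n _ <-]; exact: xM.
Qed.

Lemma sqnorm_le_bound (x : V) (M : R) :
  (forall n, \sum_(0 <= k < n) sqnorm (x k) <= M) -> sqnorm x <= M.
Proof.
move=> xM; rewrite sqnorm_hilbert_sum; apply: limr_le; first exact: hilbert_sumP.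
by apply: nearW => n; exact: xM.
Qed.

Lemma cauchy_component (F : set_system V) k : ProperFilter F -> cauchy F ->
  cauchy ((fun x : V => x k) @ F).
Proof.
move=> FF Fc; apply/cauchy_ballP => e /gt0_realC[r r0 ->].
have r20 : 0 < r ^+ 2 by rewrite exprn_gt0.
have [A FA hA] := cauchy_sqnorm FF Fc r20.
pose B := (fun x : V => x k) @` A.
have FB : F ((fun x : V => x k) @^-1` B) by apply: filterS FA => x Ax; exists x.
exists (B, B) => //= -[_ _] /= [[x Ax <-] [y Ay <-]].
rewrite -ball_normE /ball_/= norm_lt_sqnorm// -hilbert_sumB.
exact: le_lt_trans (sqnorm_component_le _ _) (hA _ _ Ax Ay).
Qed.

Fact hilbert_sum_complete (F : set_system V) :
  ProperFilter F -> cauchy F -> cvg F.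
Proof.
move=> FF Fc.
pose l k : H k := lim ((fun x : V => x k) @ F).
have lP k : (fun x : V => x k) @ F --> l k.
  by apply: cauchy_cvg; exact: cauchy_component.
have close (r : R) : 0 < r -> exists2 A : set V, F A &
    forall x, A x -> forall n, \sum_(0 <= k < n) sqnorm (l k - x k) <= r.
  move=> r0; have r40 : 0 < r / 4 by rewrite divr_gt0.
  have [A FA hA] := cauchy_sqnorm FF Fc r40.
  exists A => // x Ax n.
  have rn0 : 0 < r / 4 / n.+1%:R by rewrite divr_gt0.
  have [y [Ay ly]] : exists y : V, A y /\
      forall k, (k < n)%N -> sqnorm (l k - y k) < r / 4 / n.+1%:R.
    have : \forall y \near F, forall k : 'I_n,
        sqnorm (l k - (y : V) k) < r / 4 / n.+1%:R.
      apply: filter_forall => k.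
      exact: (cvg_sqnormP (@fmap_proper_filter _ _ _ _ FF) (lP k) rn0).
    move=> /(filterI FA)/filter_ex[y [Ay hy]].
    by exists y; split=> // k kn; exact: (hy (Ordinal kn)).
  apply: (@le_trans _ _ (\sum_(0 <= k < n)
      (2 * (r / 4 / n.+1%:R) + 2 * sqnorm ((y - x) k)))).
    apply: ler_sum_nat => k /andP[_ kn].
    have -> : l k - x k = (l k - y k) + (y - x) k.
      by rewrite hilbert_sumB addrA subrK.
    apply: le_trans (sqnormD_le _ _) _.
    by rewrite lerD2r ler_pM2l// ltW// ly.
  rewrite big_split/= -[X in _ + X]mulr_sumr.
  have h1 : \sum_(0 <= k < n) sqnorm ((y - x) k) <= r / 4.
    by apply: le_trans (sqnorm_sum_le _ _) _; rewrite ltW// hA.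
  have h2 : \sum_(0 <= k < n) (2 * (r / 4 / n.+1%:R)) <= 2 * (r / 4).
    rewrite sumr_const_nat subn0 -[leLHS]mulr_natr.
    have -> : 2 * (r / 4 / n.+1%:R) * n%:R = 2 * (r / 4) * (n%:R / n.+1%:R).
      by ring.
    apply: ler_piMr; first by lra.
    by rewrite ler_pdivrMr// mul1r ler_nat leqnSn.
  by lra.
have lS : square_summable l.
  have [A FA hA] := close 1 ltr01; have [x Ax] := filter_ex FA.
  apply: (@bounded_square_summable _ (2 * 1 + 2 * sqnorm x)) => n.
  apply: (@le_trans _ _ (\sum_(0 <= k < n)
      (2 * sqnorm (l k - x k) + 2 * sqnorm (x k)))).
    apply: ler_sum_nat => k _; rewrite -{1}(subrK (x k) (l k)).
    exact: sqnormD_le.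
  rewrite big_split/= -!mulr_sumr lerD// ler_pM2l//; first exact: hA.
  exact: sqnorm_sum_le.
apply/cvg_ex; exists (@HilbertSum _ lS); apply: cvg_sqnorm => r r0.
have [A FA hA] : exists2 A : set V, F A &
    forall x, A x -> forall n, \sum_(0 <= k < n) sqnorm (l k - x k) <= r / 2.
  by apply: close; rewrite divr_gt0.
apply: filterS FA => x Ax; apply: (@le_lt_trans _ _ (r / 2)); last by lra.
apply: sqnorm_le_bound => n; apply: le_trans (hA x Ax n).
by apply: ler_sum => k _; rewrite hilbert_sumB.
Qed.

HB.instance Definition _ := Uniform_isComplete.Build V hilbert_sum_complete.
End HilbertSum.

Section Operators.
Variables (R : realType) (H : hilbertType R[i]).
Implicit Types (T A B : H -> H) (K : set H).

Definition bounded_operator T : Prop :=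
  linear T /\ exists M : R, forall x, `|T x| <= M%:C%C * `|x|.

(* By the Riesz theorem the vector z always exists (and is unique) when T is a
   bounded operator. *)
Definition adjoint T (y : H) : H :=
  xget 0 [set z | forall x, '[T x, y] = '[x, z]].

Definition operator_le A B : Prop := forall x, 0 <= '[B x - A x, x].

Definition is_basis K n (b : 'I_n -> H) : Prop :=
  (forall i, K (b i)) /\
  (forall x, K x -> exists! c : 'rV[R[i]]_n, x = \sum_i c 0 i *: b i).

(* All the finite bases of a subspace have the same number of elements, and the
   infimum of the empty set is +oo: this is the dimension of the subspace K, all
   the infinite dimensions being identified with +oo. *)
Definition dimension K : \bar R :=
  ereal_inf [set (n%:R)%:E | n in [set n | exists b : 'I_n -> H, is_basis K b]].

Variables (d : nat) (T : 'I_d -> H -> H).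

Definition commuting_tuple : Prop := forall i j, T i \o T j = T j \o T i.

Definition contractive_tuple : Prop :=
  (forall i, bounded_operator (T i)) /\
  operator_le (fun x => \sum_i T i (adjoint (T i) x)) idfun.

(* P_T *)
Definition tuple_map (X : H -> H) : H -> H :=
  fun x => \sum_i T i (X (adjoint (T i) x)).

(* \Delta_{T^n} *)
Definition defect_dimension (n : nat) : \bar R :=
  dimension (closure (range (fun x => x - iter n tuple_map idfun x))).

Definition maximal_commuting_tuple : Prop :=
  [/\ commuting_tuple, contractive_tuple &
   forall n, (0 < n)%N -> defect_dimension n =
     ((\sum_(0 <= k < n) 'C(k + d - 1, d - 1))%:R%:E * defect_dimension 1)%E].

End Operators.

Definition fock_space (R : realType) (d : nat) : hilbertType R[i] :=
  hilbert_sum (tensor_power R d).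

Section Tensors.
Variables (R : realType) (d : nat).
Implicit Types (k : nat) (x : 'rV[R[i]]_d).

Definition pure_tensor k (y : 'I_k -> 'rV[R[i]]_d) : tensor_power R d k :=
  [ffun w => \prod_i y i 0 (tnth w i)].

(* the unitary U_s acting by permutation of the factors; perm_pure_tensor checks
   that this is its expression in coordinates *)
Definition perm_tensor k (s : 'S_k) (f : tensor_power R d k) :
    tensor_power R d k :=
  [ffun w => f [tuple tnth w (s i) | i < k]].

Lemma perm_pure_tensor k (s : 'S_k) (y : 'I_k -> 'rV[R[i]]_d) :
  perm_tensor s (pure_tensor y) = pure_tensor (fun i => y ((s^-1)%g i)).
Proof.
apply/ffunP => w; rewrite !ffunE [RHS](reindex_inj (@perm_inj _ s))/=.
by apply: eq_bigr => i _; rewrite tnth_mktuple permK.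
Qed.

Lemma perm_tensor_linear k (s : 'S_k) : linear (@perm_tensor k s).
Proof. by move=> a f g; apply/ffunP => w; rewrite !ffunE. Qed.

Lemma perm_tensorB k (s : 'S_k) (f g : tensor_power R d k) :
  perm_tensor s (f - g) = perm_tensor s f - perm_tensor s g.
Proof. by apply/ffunP => w; rewrite !ffunE. Qed.

Lemma sqnorm_perm_tensor k (s : 'S_k) f : sqnorm (perm_tensor s f) = sqnorm f.
Proof.
rewrite !sqnorm_tensor [RHS](reindex (fun w : k.-tuple 'I_d =>
  [tuple tnth w (s i) | i < k]))/=.
  by apply: eq_bigr => w _; rewrite ffunE.
exists (fun w => [tuple tnth w ((s^-1)%g i) | i < k]) => w _;
  by apply: eq_from_tnth => i; rewrite !tnth_mktuple ?permK ?permKV.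
Qed.

(* x (x) f *)
Definition tensor_cons x k (f : tensor_power R d k) : tensor_power R d k.+1 :=
  [ffun w => x 0 (thead w) * f (behead_tuple w)].

Lemma tensor_cons_pure x k (y : 'I_k -> 'rV[R[i]]_d) :
  tensor_cons x (pure_tensor y) =
  pure_tensor (fun i => oapp y x (unlift ord0 i)).
Proof.
apply/ffunP => w; rewrite !ffunE big_ord_recl unlift_none/=; congr (_ * _).
apply: eq_bigr => i _; rewrite liftK/= [w in RHS]tuple_eta.
by congr (y i 0 _); rewrite !(tnth_nth (thead w)).
Qed.

Lemma sqnorm_tensor_cons x k (f : tensor_power R d k) :
  sqnorm (tensor_cons x f) =
  (\sum_j (complex.Re (x 0 j) ^+ 2 + complex.Im (x 0 j) ^+ 2)) * sqnorm f.
Proof.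
rewrite !sqnorm_tensor big_distrlr/= pair_big/=.
rewrite (reindex (fun p : 'I_d * k.-tuple 'I_d => cons_tuple p.1 p.2))/=; last first.
  exists (fun w => (thead w, behead_tuple w)) => [[j w] _|w _]/=.
    by rewrite theadE; congr (_, _); apply: val_inj.
  by rewrite [RHS]tuple_eta; apply: val_inj.
apply: eq_bigr => -[j w] _ /=; rewrite ffunE theadE.
have -> : behead_tuple (cons_tuple j w) = w by apply: val_inj.
by case: (x 0 j) (f w) => [a b] [g h] /=; ring.
Qed.

Definition creation_components x (xi : fock_space R d) k : tensor_power R d k :=
  if k is k'.+1 then tensor_cons x (xi k') else 0.

Fact creation_subproof x xi :
  square_summable (H := tensor_power R d) (creation_components x xi).
Proof.
pose c := \sum_j (complex.Re (x 0 j) ^+ 2 + complex.Im (x 0 j) ^+ 2).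
have c0 : 0 <= c by apply: sumr_ge0 => j _; rewrite addr_ge0// sqr_ge0.
apply: (@bounded_square_summable _ _ _ (c * sqnorm xi)) => -[|n].
  by rewrite big_geq// mulr_ge0// sqnorm_ge0.
rewrite big_nat_recl//= sqnorm0 add0r.
under eq_bigr do rewrite sqnorm_tensor_cons -/c.
by rewrite -mulr_sumr ler_wpM2l// sqnorm_sum_le.
Qed.

(* the left creation operator xi |-> x (x) xi of the full Fock space *)
Definition creation x (xi : fock_space R d) : fock_space R d :=
  HilbertSum (@creation_subproof x xi).

Definition symmetric_tensors : {pred fock_space R d} :=
  fun xi => `[< forall k (s : 'S_k), perm_tensor s (xi k) = xi k >].

Fact symmetric_tensors_submod : submod_closed symmetric_tensors.
Proof.
split=> [|a xi eta /asboolP xiS /asboolP etaS]; apply/asboolP => k s.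
  by apply/ffunP => w; rewrite !ffunE.
by rewrite hilbert_sumD hilbert_sumZ perm_tensor_linear xiS etaS.
Qed.

HB.instance Definition _ := GRing.isSubmodClosed.Build R[i] (fock_space R d)
  symmetric_tensors symmetric_tensors_submod.

End Tensors.

Record sym_fock_space (R : realType) (d : nat) : Type := SymFock {
  sym_fock_val :> fock_space R d ;
  _ : sym_fock_val \in @symmetric_tensors R d }.

Section SymmetricFock.
Variables (R : realType) (d : nat).
Local Notation S := (sym_fock_space R d).

HB.instance Definition _ := [isSub for @sym_fock_val R d].
HB.instance Definition _ := [Choice of S by <:].
HB.instance Definition _ := [SubChoice_isSubLmodule of S by <:].

Definition sym_fock_dot (xi eta : S) : R[i] := '[val xi, val eta].

Fact sym_fock_dot_linear z : linear_for *%R (sym_fock_dot ^~ z).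
Proof.
by move=> a u v; rewrite /sym_fock_dot linearP linearDl linearZl_LR.
Qed.

Fact sym_fock_dot_conj x y : sym_fock_dot x y = (sym_fock_dot y x)^*.
Proof. exact: dotC. Qed.

Fact sym_fock_dot_gt0 x : x != 0 -> 0 < sym_fock_dot x x.
Proof. by move=> x0; rewrite /sym_fock_dot dnorm_gt0. Qed.

HB.instance Definition _ := Lmodule_isPreHilbert.Build R[i] S
  sym_fock_dot_linear sym_fock_dot_conj sym_fock_dot_gt0.

Lemma sym_fock_dotE (xi eta : S) : '[xi, eta] = '[val xi, val eta].
Proof. by []. Qed.

Lemma sqnorm_sym_fock (xi : S) : sqnorm xi = sqnorm (val xi).
Proof. by []. Qed.

Lemma sym_fock_valB (x y : S) : val (x - y) = val x - val y.
Proof. by []. Qed.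

Fact sym_fock_complete (F : set_system S) :
  ProperFilter F -> cauchy F -> cvg F.
Proof.
move=> FF Fc.
have GF : ProperFilter ((val : S -> fock_space R d) @ F) by exact: fmap_proper_filter.
have Gc : cauchy ((val : S -> fock_space R d) @ F).
  apply/cauchy_ballP => e /gt0_realC[r r0 ->].
  have r20 : 0 < r ^+ 2 by rewrite exprn_gt0.
  have [A FA hA] := cauchy_sqnorm FF Fc r20.
  pose B := (val : S -> fock_space R d) @` A.
  have FB : F (val @^-1` B) by apply: filterS FA => x Ax; exists x.
  exists (B, B) => //= -[_ _] /= [[x Ax <-] [y Ay <-]].
  by rewrite -ball_normE /ball_/= norm_lt_sqnorm// -sym_fock_valB; exact: hA.
have [l lP] : exists l : fock_space R d, (val : S -> fock_space R d) @ F --> l.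
  by apply/cvg_ex; exact: (cauchy_cvg _ Gc).
have near_l (r : R) : 0 < r -> \forall x \near F, sqnorm (l - val x) < r.
  by move=> r0; exact: (cvg_sqnormP GF lP r0).
have lS : l \in @symmetric_tensors R d.
  apply/asboolP => k s; apply/eqP; rewrite -subr_eq0; apply/eqP/sqnorm_eq0.
  apply/eqP; rewrite eq_le sqnorm_ge0 andbT; apply/ler_addgt0Pr => r r0.
  have /near_l/filter_ex[xi xir] : 0 < r / 4 by rewrite divr_gt0.
  have /asboolP xiS := valP xi.
  have lxi : sqnorm (l k - val xi k) < r / 4.
    by rewrite -hilbert_sumB (le_lt_trans (sqnorm_component_le _ _)).
  have -> : perm_tensor s (l k) - l k =
      perm_tensor s (l k - val xi k) - (l k - val xi k).
    by rewrite perm_tensorB xiS opprB addrA subrK.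
  apply: le_trans (sqnormD_le _ _) _.
  by rewrite sqnormN sqnorm_perm_tensor; lra.
apply/cvg_ex; exists (SymFock lS); apply: cvg_sqnorm => r /near_l.
by apply: filterS => x; rewrite sqnorm_sym_fock sym_fock_valB.
Qed.

HB.instance Definition _ := Uniform_isComplete.Build S sym_fock_complete.

(* the orthogonal projection P_s of the full Fock space onto its closed subspace
   of symmetric vectors *)
Definition sym_proj (xi : fock_space R d) : S :=
  xget 0 [set eta | forall zeta : S, '[xi - val eta, val zeta] = 0].

Definition d_shift (e : 'I_d -> 'rV[R[i]]_d) (i : 'I_d) (xi : S) : S :=
  sym_proj (creation (e i) (val xi)).

(* d orthonormal vectors of C^d automatically form a basis *)
Definition orthonormal_basis (e : 'I_d -> 'rV[R[i]]_d) : Prop :=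
  forall i j, \sum_k e i 0 k * (e j 0 k)^* = (i == j)%:R.

End SymmetricFock.

(* Main.v *)
Require Import Defs.
From HB Require Import structures.
From mathcomp Require Import all_boot all_order all_fingroup all_algebra.
From mathcomp Require Import complex ring.
From mathcomp Require Import all_classical all_reals all_analysis.

Set Implicit Arguments.
Unset Strict Implicit.
Unset Printing Implicit Defensive.

Import Order.TTheory GRing.Theory Num.Theory.
Import numFieldNormedType.Exports.

Local Open Scope ring_scope.

(** The adjoint of the shift S_i is annihilation L_i, which contracts the first
tensor factor with e_i; it maps symmetric tensors to symmetric tensors, so no
projection is needed to describe it ([adjoint_d_shift]). Everything is read off
from the L_i. They commute, because exchanging the first two letters of a word
does not change a coefficient of a symmetric tensor, and hence so do the S_i.
By completeness of the orthonormal basis, the sum of the e_i (x) L_i x is x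
without its vacuum component; this vector is already symmetric, so the sum of
the S_i S_i^* is the identity minus the projection onto the vacuum
([sum_d_shift_adjoint]).

Since L_i lowers the degree by one, an induction gives that P_S^n(I) is the
projection onto the components of degree at least n ([iter_tuple_map]). Thus
I - P_S^n(I) is the projection onto the symmetric tensors of degree less than
n, a closed space. A symmetric tensor is determined by its coefficients on the
nondecreasing words, which are arbitrary; there are binomial(k + d - 1, d - 1)
such words of length k on d letters. Summing over k < n gives the dimension,
which is 1 for n = 1, where the only word is empty ([dimension_low_degree]). *)

(** * Inner products and adjoints *)

(** The generic sesquilinearity lemmas leave a redex that only simplification
removes, and simplification would also unfold the concrete inner products of
the Fock spaces; hence these versions with the redex already reduced. *)
Section Dot.
Variables (C : numClosedFieldType) (H : preHilbertType C).
Implicit Types x y z : H.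

Lemma dotBl x y z : '[x - y, z] = '[x, z] - '[y, z].
Proof. exact: linearBl. Qed.

Lemma dotZl a x z : '[a *: x, z] = a * '[x, z].
Proof. exact: linearZl_LR. Qed.

Lemma dotPl a x y z : '[a *: x + y, z] = a * '[x, z] + '[y, z].
Proof. by rewrite linearDl linearZl_LR. Qed.

Lemma dot_suml I (r : seq I) (F : I -> H) z :
  '[\sum_(i <- r) F i, z] = \sum_(i <- r) '[F i, z].
Proof. exact: linear_sumlz. Qed.

Lemma dot_injl x y : (forall z, '[x, z] = '[y, z]) -> x = y.
Proof.
move=> xy; apply/eqP; rewrite -subr_eq0 -(dnorm_eq0 (@dot C H)).
by rewrite dotBl xy subrr.
Qed.
End Dot.

(** It is enough to exhibit an adjoint, since a vector is determined by its
inner products. *)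
Lemma adjoint_eq (R : realType) (H : hilbertType R[i]) (T T' : H -> H) :
  (forall x y, '[T x, y] = '[x, T' y]) -> adjoint T = T'.
Proof.
move=> TT'; apply/funext => y; apply: xget_unique => [x /=|z zP].
  exact: TT'.
by apply: dot_injl => x; rewrite dotC -zP TT' -dotC.
Qed.

(** By the Cauchy-Schwarz inequality, the square norm of T' y, which is the inner
product of T (T' y) and y, satisfies |T' y|^4 <= c |T' y|^2 |y|^2. *)
Lemma sqnorm_adjoint_le (R : realType) (H K : preHilbertType R[i])
    (T : H -> K) (T' : K -> H) (c : R) :
  0 <= c -> (forall x y, '[T x, y] = '[x, T' y]) ->
  (forall x, sqnorm (T x) <= c * sqnorm x) ->
  forall y, sqnorm (T' y) <= c * sqnorm y.
Proof.
move=> c0 TT' Tc y; have [->|A0] := eqVneq (sqnorm (T' y)) 0.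
  by rewrite mulr_ge0 ?sqnorm_ge0.
have {}A0 : 0 < sqnorm (T' y) by rewrite lt0r A0 sqnorm_ge0.
have := dot_CauchySchwarz (@dot R[i] K) (T (T' y)) y.
rewrite TT' !sqnormE ger0_norm ?ler0c ?(ltW A0)//.
rewrite -rmorphXn/= -rmorphM/= lecR => CS.
rewrite -(ler_pM2l A0) -expr2; apply: le_trans CS _.
by rewrite mulrCA mulrA ler_wpM2r ?sqnorm_ge0.
Qed.

Lemma norm_le_sqnorm (R : realType) (H K : preHilbertType R[i]) (x : H) (y : K)
    (c : R) : 0 <= c -> sqnorm y <= c * sqnorm x ->
  `|y| <= (Num.sqrt c)%:C%C * `|x|.
Proof.
move=> c0 yx; have sc0 : 0 <= (Num.sqrt c)%:C%C by rewrite ler0c sqrtr_ge0.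
rewrite -(@ler_pXn2r _ 2)// ?nnegrE ?mulr_ge0// exprMn.
by rewrite -!dot_normE !sqnormE -rmorphXn/= sqr_sqrtr// -rmorphM/= lecR.
Qed.

(** * Dimension *)

Section Dimension.
Variables (R : realType) (H : hilbertType R[i]) (K : set H).

(** The transition matrices between the two families satisfy A B = 1, which forces
m <= n. *)
Lemma is_basis_leq m n (b : 'I_m -> H) (c : 'I_n -> H) :
  is_basis K b -> is_basis K c -> (m <= n)%N.
Proof.
move=> [Kb bP] [Kc cP].
have /choice[A AP] i : exists a : 'rV[R[i]]_n, b i = \sum_j a 0 j *: c j.
  by have [a [aP _]] := cP _ (Kb i); exists a.
have /choice[B BP] j : exists a : 'rV[R[i]]_m, c j = \sum_i a 0 i *: b i.
  by have [a [aP _]] := bP _ (Kc j); exists a.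
apply: (@mulmx1_min _ _ _ (\matrix_i A i) (\matrix_j B j)).
apply/row_matrixP => i; have [a [_ a_uniq]] := bP _ (Kb i).
transitivity a; last apply: a_uniq.
  apply/esym/a_uniq; rewrite AP; under eq_bigr => j _ do rewrite BP scaler_sumr.
  rewrite exchange_big; apply: eq_bigr => k _ /=.
  rewrite !mxE scaler_suml; apply: eq_bigr => j _.
  by rewrite scalerA !mxE.
rewrite (bigD1 i)//= !mxE eqxx scale1r big1 ?addr0// => j ji.
by rewrite !mxE eq_sym (negbTE ji) scale0r.
Qed.

Lemma dimension_basis n (b : 'I_n -> H) : is_basis K b -> dimension K = (n%:R)%:E.
Proof.
move=> bK; rewrite /dimension.
rewrite (_ : [set _ | _ in _]%classic = [set (n%:R)%:E]%classic) ?ereal_inf1//.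
apply/seteqP; split=> [_ [m /= [c cK] <-]|_ ->]; last by exists n => //; exists b.
suff -> : m = n by [].
by apply/eqP; rewrite eqn_leq (is_basis_leq cK bK) (is_basis_leq bK cK).
Qed.

(** A dual family of linear forms replaces the check that coordinates are unique. *)
Lemma dimension_dual_basis (I : finType) (b : I -> H) (phi : I -> {scalar H}) :
  (forall i, K (b i)) -> (forall i j, phi i (b j) = (i == j)%:R) ->
  (forall x, K x -> x = \sum_i phi i x *: b i) -> dimension K = (#|I|%:R)%:E.
Proof.
move=> Kb dual span.
apply: (@dimension_basis _ (fun k => b (enum_val k))); split=> [k|x Kx]; first exact: Kb.
exists (\row_k phi (enum_val k) x); split=> [|c xc].
  rewrite {1}(span x Kx) (reindex (@enum_val I predT))/=; last first.
    exact/onW_bij/enum_val_bij.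
  by apply: eq_bigr => k _; rewrite mxE.
apply/rowP => k; rewrite mxE xc linear_sum (bigD1 k)//= linearZ/= dual eqxx mulr1.
rewrite big1 ?addr0// => l lk; rewrite linearZ/= dual.
by rewrite (inj_eq enum_val_inj) eq_sym (negbTE lk) mulr0.
Qed.
End Dimension.

(** * Symmetric tensors *)

Section SymmetricTensors.
Variables (R : realType) (d : nat).

Definition row_sqnorm (x : 'rV[R[i]]_d) : R :=
  \sum_j (complex.Re (x 0 j) ^+ 2 + complex.Im (x 0 j) ^+ 2).

Lemma row_sqnorm_ge0 x : 0 <= row_sqnorm x.
Proof. by apply: sumr_ge0 => j _; rewrite addr_ge0// sqr_ge0. Qed.

(** The coefficients of a symmetric tensor depend on words up to rearrangement;
this form of the invariance avoids handling permutations of positions. *)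
Definition symmetric_tensor k (f : tensor_power R d k) : Prop :=
  forall v w : k.-tuple 'I_d, perm_eq v w -> f v = f w.

Lemma symmetric_tensorP k (f : tensor_power R d k) :
  symmetric_tensor f <-> forall s, perm_tensor s f = f.
Proof.
split=> [fS s|fS v w /tuple_permP[s /val_inj->]]; last by rewrite -{2}(fS s) ffunE.
by apply/ffunP => w; rewrite ffunE; apply: fS; apply/tuple_permP; exists s.
Qed.

Definition symmetrization k (f : tensor_power R d k) : tensor_power R d k :=
  (k`!%:R)^-1 *: \sum_(s : 'S_k) perm_tensor s f.

Lemma symmetrization_symmetric k (f : tensor_power R d k) :
  symmetric_tensor (symmetrization f).
Proof.
apply/symmetric_tensorP => t; apply/ffunP => w.
rewrite !ffunE !sum_ffunE; congr (_ * _).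
rewrite [RHS](reindex_inj (mulIg t))/=.
apply: eq_bigr => s _; rewrite !ffunE; congr (f _).
by apply: eq_from_tnth => i; rewrite !tnth_mktuple permM.
Qed.

Lemma dot_perm_tensor k (s : 'S_k) (f g : tensor_power R d k) :
  '[perm_tensor s f, perm_tensor s g] = '[f, g].
Proof.
rewrite !tensor_dotE [RHS](reindex (fun w : k.-tuple 'I_d =>
  [tuple tnth w (s i) | i < k]))/=.
  by apply: eq_bigr => w _; rewrite !ffunE.
exists (fun w => [tuple tnth w ((s^-1)%g i) | i < k]) => w _;
  by apply: eq_from_tnth => i; rewrite !tnth_mktuple ?permK ?permKV.
Qed.

(** The permutations act unitarily and fix g, so each of the k! terms of the
average has the same inner product with g: symmetrization is the orthogonal
projection onto the symmetric tensors. *)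
Lemma dot_symmetrization k (f g : tensor_power R d k) :
  symmetric_tensor g -> '[symmetrization f, g] = '[f, g].
Proof.
move=> /symmetric_tensorP gS; rewrite dotZl dot_suml.
rewrite (eq_bigr (fun=> '[f, g])) => [/=|s _]; last first.
  by rewrite -[RHS](dot_perm_tensor s) gS.
rewrite sumr_const card_Sn -[X in _ * X]mulr_natl mulrA mulVf ?mul1r//.
Qed.

Lemma sqnorm_symmetrization_le k (f : tensor_power R d k) :
  sqnorm (symmetrization f) <= sqnorm f.
Proof.
have fS := @symmetrization_symmetric _ f; set g := symmetrization f in fS *.
have fg : '[f - g, g] = 0 by rewrite dotBl -(dot_symmetrization f fS) subrr.
by rewrite -[f in leRHS](subrK g) sqnormDE fg/= mul0rn addr0 lerDr sqnorm_ge0.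
Qed.

(** Contraction of the first tensor factor with x. *)
Definition annihilate (x : 'rV[R[i]]_d) k (f : tensor_power R d k.+1) :
    tensor_power R d k :=
  [ffun w => \sum_j (x 0 j)^* * f (cons_tuple j w)].

Lemma big_cons_tuple k (F : k.+1.-tuple 'I_d -> R[i]) :
  \sum_w F w = \sum_j \sum_w F (cons_tuple j w).
Proof.
rewrite pair_big/= (reindex (fun p : 'I_d * k.-tuple 'I_d => cons_tuple p.1 p.2))//=.
exists (fun w => (thead w, behead_tuple w)) => [[j w] _|w _]/=.
  by rewrite theadE; congr (_, _); apply: val_inj.
by rewrite [RHS]tuple_eta; apply: val_inj.
Qed.

Lemma tensor_consE x k (f : tensor_power R d k) j w :
  tensor_cons x f (cons_tuple j w) = x 0 j * f w.
Proof. by rewrite ffunE theadE; congr (_ * f _); apply: val_inj. Qed.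

Lemma dot_tensor_cons x k (f : tensor_power R d k) (g : tensor_power R d k.+1) :
  '[tensor_cons x f, g] = '[f, annihilate x g].
Proof.
rewrite !tensor_dotE big_cons_tuple exchange_big; apply: eq_bigr => w _ /=.
rewrite ffunE rmorph_sum/= mulr_sumr; apply: eq_bigr => j _.
by rewrite tensor_consE rmorphM/= conjCK; ring.
Qed.

Lemma annihilate_symmetric x k (f : tensor_power R d k.+1) :
  symmetric_tensor f -> symmetric_tensor (annihilate x f).
Proof.
move=> fS v w vw; rewrite !ffunE; apply: eq_bigr => j _; congr (_ * _).
by apply: fS; rewrite /= perm_cons.
Qed.

(** Both sides contract the first two factors of f, in the two possible orders,
and f is invariant under their exchange. *)
Lemma annihilateC x y k (f : tensor_power R d k.+2) : symmetric_tensor f ->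
  annihilate x (annihilate y f) = annihilate y (annihilate x f).
Proof.
move=> fS; apply/ffunP => w; rewrite !ffunE.
under eq_bigr => j _ do rewrite ffunE mulr_sumr.
under [RHS]eq_bigr => j _ do rewrite ffunE mulr_sumr.
rewrite exchange_big; apply: eq_bigr => i _; apply: eq_bigr => j _ /=.
rewrite mulrCA; congr (_ * (_ * _)); apply: fS.
by rewrite /= -(cat1s i) -(cat1s j) perm_catCA.
Qed.

Lemma sqnorm_annihilate_le (x : 'rV[R[i]]_d) k (f : tensor_power R d k.+1) :
  sqnorm (annihilate x f) <= row_sqnorm x * sqnorm f.
Proof.
move: f; apply: (sqnorm_adjoint_le _ (@dot_tensor_cons x k)) => [|f].
  exact: row_sqnorm_ge0.
by rewrite sqnorm_tensor_cons.
Qed.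

End SymmetricTensors.

(** * Hilbert sums *)

Section HilbertSums.
Variables (R : realType).

Lemma limn_series_shift (u v : nat -> R) :
  u 0%N = 0 -> (forall k, u k.+1 = v k) -> cvgn (series v) ->
  limn (series u) = limn (series v).
Proof.
move=> u0 uv vcvg; apply: cvg_lim => //; rewrite -cvg_shiftS.
rewrite (_ : [sequence _]_n = series v)//; apply/funext => n /=.
by rewrite seriesEnat/= big_nat_recl//= u0 add0r; apply: eq_bigr => k _; rewrite uv.
Qed.

Lemma hilbert_sum_dot_eq (H H' : nat -> hilbertType R[i])
    (x y : hilbert_sum H) (x' y' : hilbert_sum H') :
  (forall k, '[x k, y k] = '[x' k, y' k]) -> '[x, y] = '[x', y'].
Proof.
move=> xy; rewrite !hilbert_sum_dotE.
by congr (limn (series _) +i* limn (series _))%C; apply/funext => k; rewrite xy.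
Qed.

(** For operators that shift the degree by one, such as creation. *)
Lemma hilbert_sum_dot_shift (H H' : nat -> hilbertType R[i])
    (x y : hilbert_sum H) (x' y' : hilbert_sum H') :
  '[x 0%N, y 0%N] = 0 -> (forall k, '[x k.+1, y k.+1] = '[x' k, y' k]) ->
  '[x, y] = '[x', y'].
Proof.
move=> xy0 xy; rewrite !hilbert_sum_dotE; congr (_ +i* _)%C.
  by apply: limn_series_shift; [rewrite xy0|move=> k; rewrite xy|exact: is_cvg_Re_dot].
by apply: limn_series_shift; [rewrite xy0|move=> k; rewrite xy|exact: is_cvg_Im_dot].
Qed.

Lemma finite_square_summable (H : nat -> hilbertType R[i]) (x : forall k, H k) n :
  (forall k, (n <= k)%N -> x k = 0) -> square_summable x.
Proof.
move=> x0; apply: (@bounded_square_summable _ _ _ (\sum_(0 <= k < n) sqnorm (x k))) => m.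
have [mn|nm] := leqP m n.
  rewrite (big_cat_nat (n := m) (p := n))//= lerDl sumr_ge0// => k _.
  exact: sqnorm_ge0.
rewrite (big_cat_nat (n := n) (p := m)) ?(ltnW nm)//= gerDl.
by rewrite big_nat big1// => k /andP[nk _]; rewrite x0// sqnorm0.
Qed.

Lemma sub_square_summable (H : nat -> hilbertType R[i]) (x : forall k, H k)
  (y : hilbert_sum H) :
  (forall k, sqnorm (x k) <= sqnorm (y k)) -> square_summable x.
Proof.
move=> xy; apply: (@bounded_square_summable _ _ _ (sqnorm y)) => n.
by apply: le_trans (sqnorm_sum_le y n); apply: ler_sum => k _.
Qed.

End HilbertSums.

(** * The symmetric Fock space *)

Section SymmetricFockSpace.
Variables (R : realType) (d : nat).
Local Notation S := (sym_fock_space R d).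
Local Notation sym := (@symmetric_tensors R d).

Lemma symmetric_tensorsP (xi : fock_space R d) :
  reflect (forall k, symmetric_tensor (xi k)) (xi \in sym).
Proof.
apply: (iffP idP) => [/asboolP xiS k|xiS].
  by apply/symmetric_tensorP => s.
apply/asboolP => k s.
by move/symmetric_tensorP: (xiS k).
Qed.

Lemma sym_fock_symmetric (x : S) k : symmetric_tensor (val x k).
Proof. by move: k; apply/symmetric_tensorsP; exact: valP. Qed.

Lemma sym_fock_ext (x y : S) : (forall k, val x k = val y k) -> x = y.
Proof. by move=> xy; apply: val_inj; exact: hilbert_sum_ext. Qed.

Lemma sym_fock_sumE I (r : seq I) (F : I -> S) k w :
  val (\sum_(i <- r) F i : S) k w = \sum_(i <- r) val (F i) k w.
Proof.
elim: r => [|i r IHr]; first by rewrite !big_nil ffunE.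
by rewrite !big_cons -IHr [LHS]ffunE.
Qed.

Definition symmetrize_components (xi : fock_space R d) k : tensor_power R d k :=
  symmetrization (xi k).

Fact symmetrize_subproof xi :
  square_summable (H := tensor_power R d) (symmetrize_components xi).
Proof. exact: sub_square_summable (fun k => sqnorm_symmetrization_le (xi k)). Qed.

Fact symmetrize_symmetric xi :
  (HilbertSum (@symmetrize_subproof xi) : fock_space R d) \in sym.
Proof. by apply/symmetric_tensorsP => k; exact: symmetrization_symmetric. Qed.

Definition symmetrize xi : S := SymFock (symmetrize_symmetric xi).

(** This characterization of the projection is all that is used about it; its
existence comes from symmetrizing every component. *)
Lemma dot_sym_proj (xi : fock_space R d) (z : S) :
  '[sym_proj xi, z] = '[xi, val z].
Proof.
have symP : forall z : S, '[xi - val (symmetrize xi), val z] = 0.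
  move=> {}z; rewrite dotBl; apply/eqP; rewrite subr_eq0 eq_sym; apply/eqP.
  apply: hilbert_sum_dot_eq => k.
  by apply: dot_symmetrization; exact: sym_fock_symmetric.
have := @xgetPex _ 0 [set eta : S | forall z : S, '[xi - val eta, val z] = 0]%classic
  (ex_intro _ _ symP) z.
by rewrite dotBl => /eqP; rewrite subr_eq0 => /eqP.
Qed.

Lemma sum_annihilate_le (x : 'rV[R[i]]_d) (xi : S) n :
  \sum_(0 <= k < n) sqnorm (annihilate x (val xi k.+1)) <=
  row_sqnorm x * sqnorm xi.
Proof.
have x0 := row_sqnorm_ge0 x.
apply: (@le_trans _ _ (row_sqnorm x * \sum_(0 <= k < n.+1) sqnorm (val xi k))).
  rewrite big_nat_recl// mulrDr -[leLHS]add0r lerD ?mulr_ge0 ?sqnorm_ge0//.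
  by rewrite mulr_sumr; apply: ler_sum => k _; exact: sqnorm_annihilate_le.
by rewrite ler_wpM2l// sqnorm_sum_le.
Qed.

Fact annihilation_subproof (x : 'rV[R[i]]_d) (xi : S) :
  square_summable (H := tensor_power R d) (fun k => annihilate x (val xi k.+1)).
Proof. exact: bounded_square_summable (sum_annihilate_le x xi). Qed.

Fact annihilation_symmetric (x : 'rV[R[i]]_d) (xi : S) :
  (HilbertSum (@annihilation_subproof x xi) : fock_space R d) \in sym.
Proof.
apply/symmetric_tensorsP => k; apply: annihilate_symmetric.
exact: sym_fock_symmetric.
Qed.

Definition annihilation x xi : S := SymFock (annihilation_symmetric x xi).

Lemma sqnorm_annihilation_le x xi :
  sqnorm (annihilation x xi) <= row_sqnorm x * sqnorm xi.
Proof. by apply: sqnorm_le_bound => n; exact: sum_annihilate_le. Qed.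

Lemma annihilationE x xi k : val (annihilation x xi) k = annihilate x (val xi k.+1).
Proof. by []. Qed.

Lemma dot_creation x (xi eta : S) :
  '[creation x (val xi), val eta] = '[xi, annihilation x eta].
Proof.
rewrite sym_fock_dotE; apply: hilbert_sum_dot_shift => [|k]; first exact: linear0l.
exact: dot_tensor_cons.
Qed.

Lemma annihilation_comm x y xi :
  annihilation x (annihilation y xi) = annihilation y (annihilation x xi).
Proof.
apply: sym_fock_ext => k; apply: annihilateC; exact: sym_fock_symmetric.
Qed.

Fact tail_subproof n (xi : S) : square_summable (H := tensor_power R d)
  (fun k => if (n <= k)%N then val xi k else 0).
Proof.
apply: (@sub_square_summable _ _ _ (val xi)) => k.
by case: ifP => // _; rewrite sqnorm0 sqnorm_ge0.
Qed.

Fact tail_symmetric n (xi : S) :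
  (HilbertSum (@tail_subproof n xi) : fock_space R d) \in sym.
Proof.
apply/symmetric_tensorsP => k v w vw /=; case: ifP => _; last by rewrite !ffunE.
exact: sym_fock_symmetric.
Qed.

(** This is the iterate P_S^n(I): see [iter_tuple_map]. *)
Definition tail n xi : S := SymFock (tail_symmetric n xi).

Lemma tailE n xi k : val (tail n xi) k = if (n <= k)%N then val xi k else 0.
Proof. by []. Qed.

Lemma annihilation_tail x n xi :
  annihilation x (tail n.+1 xi) = tail n (annihilation x xi).
Proof.
apply: sym_fock_ext => k; rewrite annihilationE !tailE ltnS annihilationE.
case: ifP => // _; apply/ffunP => w; rewrite !ffunE big1// => j _.
by rewrite ffunE mulr0.
Qed.

End SymmetricFockSpace.

(** * The d-shift *)

Section DShift.
Variables (R : realType) (d : nat) (e : 'I_d -> 'rV[R[i]]_d).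
Hypothesis e_onb : orthonormal_basis e.
Local Notation S := (sym_fock_space R d).

Lemma dot_d_shift i (x y : S) : '[d_shift e i x, y] = '[x, annihilation (e i) y].
Proof. by rewrite dot_sym_proj dot_creation. Qed.

Lemma adjoint_d_shift i : adjoint (d_shift e i) = annihilation (e i).
Proof. by apply: adjoint_eq => x y; exact: dot_d_shift. Qed.

Lemma d_shift_commuting : commuting_tuple (d_shift e).
Proof.
move=> i j; apply/funext => x /=; apply: dot_injl => z.
(* The side of each rewriting is given, as comparing two unequal inner products
   would unfold them. *)
rewrite [LHS]dot_d_shift [LHS]dot_d_shift [RHS]dot_d_shift [RHS]dot_d_shift.
by rewrite annihilation_comm.
Qed.

Lemma d_shift_bounded i : bounded_operator (d_shift e i).
Proof.
split=> [a x y|].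
  apply: dot_injl => z; rewrite [LHS]dot_d_shift [LHS]dotPl [RHS]dotPl.
  by congr (_ * _ + _); rewrite [RHS]dot_d_shift.
exists (Num.sqrt (row_sqnorm (e i))) => x.
apply: norm_le_sqnorm (row_sqnorm_ge0 _) _; move: x.
apply: (@sqnorm_adjoint_le _ _ _ (annihilation (e i))) => [|x y|y].
- exact: row_sqnorm_ge0.
- by rewrite dotC -dot_d_shift -dotC.
- exact: sqnorm_annihilation_le.
Qed.

(** The d x d matrix of an orthonormal family is unitary, so its columns are
orthonormal too. *)
Lemma orthonormal_basis_complete a b :
  \sum_i e i 0 a * (e i 0 b)^* = (a == b)%:R.
Proof.
pose A := \matrix_(i, k) e i 0 k; pose B := \matrix_(k, i) (e i 0 k)^*.
have /mulmx1C/matrixP/(_ b a) : A *m B = 1%:M.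
  apply/matrixP => i j; rewrite !mxE -e_onb.
  by apply: eq_bigr => k _; rewrite !mxE.
rewrite !mxE eq_sym => <-.
by apply: eq_bigr => k _; rewrite !mxE mulrC.
Qed.

(** The expansion of the first tensor factor of f in the basis e. *)
Lemma sum_tensor_cons_annihilate k (f : tensor_power R d k.+1) :
  \sum_i tensor_cons (e i) (annihilate (e i) f) = f.
Proof.
apply/ffunP => w; rewrite sum_ffunE.
have -> : w = cons_tuple (thead w) (behead_tuple w).
  by rewrite {1}[w]tuple_eta; apply: val_inj.
move: (thead w) (behead_tuple w) => a {}w.
under eq_bigr => i _ do rewrite tensor_consE ffunE mulr_sumr.
rewrite exchange_big/= (bigD1 a)//= [X in _ + X]big1 => [|j jw].
  rewrite addr0 -[RHS]mul1r; under eq_bigr => i _ do rewrite mulrA.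
  by rewrite -mulr_suml orthonormal_basis_complete eqxx.
under eq_bigr => i _ do rewrite mulrA.
by rewrite -mulr_suml orthonormal_basis_complete eq_sym (negbTE jw) mul0r.
Qed.

Lemma sum_creation_annihilation (x : S) :
  \sum_i creation (e i) (val (annihilation (e i) x)) = val (tail 1 x).
Proof.
apply: hilbert_sum_ext => k; apply/ffunP => w.
transitivity (\sum_i creation (e i) (val (annihilation (e i) x)) k w).
  elim: (index_enum _) => [|i r IHr]; first by rewrite !big_nil ffunE.
  by rewrite !big_cons -IHr [LHS]ffunE.
case: k w => [|k] w /=; first by rewrite big1 ?ffunE// => i _; rewrite ffunE.
by rewrite -sum_ffunE sum_tensor_cons_annihilate.
Qed.

Lemma sum_d_shift_adjoint (x : S) :
  \sum_i d_shift e i (annihilation (e i) x) = tail 1 x.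
Proof.
apply: dot_injl => z; rewrite [LHS]dot_suml.
rewrite (eq_bigr _ (fun i _ => dot_sym_proj _ z)) -[LHS]dot_suml.
by rewrite sum_creation_annihilation.
Qed.

(** Each L_i commutes with truncation up to a shift by one of the degree, so that
the sum of the S_i tail_n L_i is the sum of the S_i L_i tail_(n+1). *)
Lemma iter_tuple_map n : iter n (tuple_map (d_shift e)) idfun = @tail R d n.
Proof.
elim: n => [|n IHn] /=; first by apply/funext => x; apply: sym_fock_ext.
apply/funext => x; rewrite IHn /tuple_map.
under eq_bigr => i _ do rewrite adjoint_d_shift -annihilation_tail.
rewrite sum_d_shift_adjoint; apply: sym_fock_ext => k; rewrite !tailE.
by case: ifP => //; case: k.
Qed.

(** The vector x - tail 1 x is the vacuum component of x. *)
Lemma dot_subr_tail_ge0 (x : S) : 0 <= '[x - tail 1 x, x].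
Proof.
have -> : '[x - tail 1 x, x] = '[x - tail 1 x, x - tail 1 x]; last exact: dnorm_ge0.
rewrite [LHS]sym_fock_dotE [RHS]sym_fock_dotE; apply: hilbert_sum_dot_eq => k.
rewrite sym_fock_valB hilbert_sumB tailE.
by case: ifP => _; rewrite ?subr0// subrr [LHS]linear0l [RHS]linear0l.
Qed.

Lemma d_shift_contractive : contractive_tuple (d_shift e).
Proof.
split=> [i|x]; first exact: d_shift_bounded.
rewrite (eq_bigr (fun i => d_shift e i (annihilation (e i) x))) => [|i _].
  by rewrite sum_d_shift_adjoint; exact: dot_subr_tail_ge0.
by rewrite adjoint_d_shift.
Qed.

(** This is the range of I - P_S^n(I): see [closure_defect_range]. *)
Definition low_degree n : set S :=
  [set x : S | forall k, (n <= k)%N -> val x k = 0]%classic.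

Lemma closed_low_degree n : closed (low_degree n).
Proof.
move=> x xcl k nk; apply: sqnorm_eq0; apply/eqP; rewrite eq_le sqnorm_ge0 andbT.
apply/ler_addgt0Pr => r r0; rewrite add0r.
have /xcl[y [/(_ k nk) yk xy]] : nbhs x [set y : S | sqnorm (x - y) < r]%classic.
  exact: (@cvg_sqnormP _ _ (nbhs x) _ x (@cvg_id _ (nbhs x)) r r0).
rewrite -[val x k]subr0 -yk -hilbert_sumB -sym_fock_valB.
exact: le_trans (sqnorm_component_le _ _) (ltW xy).
Qed.

Lemma closure_defect_range n :
  closure (range (fun x => x - iter n (tuple_map (d_shift e)) idfun x)) =
  low_degree n.
Proof.
rewrite iter_tuple_map [RHS](_ : _ = closure (low_degree n)); last first.
  by rewrite -(proj1 (closure_id _) (@closed_low_degree n)).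
congr closure; apply/seteqP; split=> [_ [x _ <-] k nk|x x0].
  by rewrite sym_fock_valB hilbert_sumB tailE nk subrr.
exists x => //; apply: sym_fock_ext => k.
rewrite sym_fock_valB hilbert_sumB tailE; case: ifP => [nk|_]; last exact: subr0.
by rewrite subrr x0.
Qed.

End DShift.

(** * Dimension of the symmetric tensors of low degree *)

Section Monomials.
Variables (R : realType) (d : nat).
Local Notation S := (sym_fock_space R d).

(** Indexing coefficients by sequences rather than tuples lets words of different
lengths share one type. *)
Definition coefficient (u : seq 'I_d) (x : S) : R[i] := val x (size u) (in_tuple u).

Fact coefficient_linear u : linear_for *%R (coefficient u).
Proof. by move=> a x y; rewrite [LHS]ffunE [X in X + _]ffunE. Qed.

HB.instance Definition _ u :=
  GRing.isLinear.Build R[i] S R[i] *%R (coefficient u) (coefficient_linear u).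

Lemma coefficient_perm (x : S) u k (w : k.-tuple 'I_d) :
  perm_eq u w -> coefficient u x = val x k w.
Proof.
move=> uw; have uk : size u = k by rewrite (perm_size uw) size_tuple.
by subst k; apply: sym_fock_symmetric.
Qed.

(** The sum of the elementary tensors over all the rearrangements of u: up to a
scalar, the monomial of the letters of u, if symmetric tensors are seen as
homogeneous polynomials. *)
Definition monomial_components (u : seq 'I_d) k : tensor_power R d k :=
  [ffun w : k.-tuple 'I_d => (perm_eq u w)%:R].

Lemma monomial_components0 u k : size u != k -> monomial_components u k = 0.
Proof.
move=> uk; apply/ffunP => w; rewrite !ffunE.
case: (boolP (perm_eq _ _)) => // /perm_size; rewrite size_tuple => /eqP.
by rewrite (negbTE uk).
Qed.

Fact monomial_subproof u :
  square_summable (H := tensor_power R d) (monomial_components u).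
Proof.
apply: (@finite_square_summable _ _ _ (size u).+1) => k uk.
by apply: monomial_components0; rewrite ltn_eqF.
Qed.

Fact monomial_symmetric u :
  (HilbertSum (@monomial_subproof u) : fock_space R d) \in @symmetric_tensors R d.
Proof.
by apply/symmetric_tensorsP => k v w vw; rewrite !ffunE (permPr vw).
Qed.

Definition monomial u : S := SymFock (monomial_symmetric u).

Lemma coefficient_monomial u v : coefficient u (monomial v) = (perm_eq v u)%:R.
Proof. exact: ffunE. Qed.

Let le_ord (i j : 'I_d) := (i <= j)%N.

(** There is one such word for each multiset of fewer than n letters. *)
Definition sorted_word n :=
  {k : 'I_n & {w : k.-tuple 'I_d | sorted leq (map val w)}}.

Definition word n (i : sorted_word n) : seq 'I_d := val (tagged i).

Lemma word_sorted n (i : sorted_word n) : sorted le_ord (word i).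
Proof. by have := valP (tagged i); rewrite sorted_map. Qed.

Lemma size_word n (i : sorted_word n) : (size (word i) < n)%N.
Proof. by rewrite size_tuple. Qed.

Lemma le_ord_anti : antisymmetric le_ord.
Proof. by move=> i j /anti_leq/val_inj. Qed.

Lemma le_ord_trans : transitive le_ord.
Proof. by move=> j i k; exact: leq_trans. Qed.

Lemma le_ord_total : total le_ord.
Proof. by move=> i j; exact: leq_total. Qed.

Lemma word_inj n : injective (@word n).
Proof.
move=> [k [u us]] [l [v vs]]; rewrite /word/= => uv.
have kl : k = l by apply: val_inj; rewrite /= -(size_tuple u) uv size_tuple.
by subst l; congr Tagged; apply/val_inj/val_inj.
Qed.

Lemma perm_eq_word n (i j : sorted_word n) : perm_eq (word i) (word j) = (i == j).
Proof.
apply/idP/eqP => [ij|->//]; apply: word_inj.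
exact: (sorted_eq le_ord_trans le_ord_anti (word_sorted i) (word_sorted j)).
Qed.

Lemma exists_word n (w : seq 'I_d) : (size w < n)%N ->
  exists i : sorted_word n, perm_eq (word i) w.
Proof.
move=> wn.
have ws : sorted leq (map val (sort_tuple le_ord (in_tuple w))).
  by rewrite sorted_map; apply: sort_sorted; exact: le_ord_total.
exists (existT (fun k : 'I_n => {w : k.-tuple 'I_d | sorted leq (map val w)})
  (Ordinal wn) (Sub (sort_tuple le_ord (in_tuple w)) ws)).
by rewrite /word/= perm_sort.
Qed.

(** Every word has exactly one nondecreasing rearrangement, and x has the same
coefficient on both. *)
Lemma low_degree_monomials n (x : S) : low_degree n x ->
  x = \sum_(i : sorted_word n) coefficient (word i) x *: monomial (word i).
Proof.
move=> xn; apply: sym_fock_ext => k; apply/ffunP => w; rewrite sym_fock_sumE.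
have zE (i : sorted_word n) : val (coefficient (word i) x *: monomial (word i)) k w =
  coefficient (word i) x * (perm_eq (word i) w)%:R by rewrite [LHS]ffunE ffunE.
rewrite (eq_bigr _ (fun i _ => zE i)); have [nk|kn] := leqP n k.
  rewrite xn// ffunE big1// => i _.
  case: (boolP (perm_eq _ _)) => [iw|_]; last by rewrite mulr0.
  by have := size_word i; rewrite (perm_size iw) size_tuple ltnNge nk.
have /exists_word[i iw] : (size w < n)%N by rewrite size_tuple.
rewrite (bigD1 i)//= iw mulr1 big1 ?addr0 => [|j ji].
  exact/esym/coefficient_perm.
by rewrite -(permPr iw) perm_eq_word (negbTE ji) mulr0.
Qed.

Lemma card_sorted_word n : (0 < d)%N ->
  #|{: sorted_word n}| = (\sum_(0 <= k < n) 'C(k + d - 1, d - 1))%N.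
Proof.
move=> d0; rewrite card_tagged sumnE big_map big_enum/= big_mkord.
apply: eq_bigr => k _; rewrite card_sig.
case: d d0 => // d' _; rewrite -addnBA// subSS subn0.
rewrite -(bin_sub (leq_addl k d')) addnK -card_sorted_tuples.
by apply: eq_card => w; rewrite !inE.
Qed.

Lemma dimension_low_degree n : (0 < d)%N ->
  dimension (@low_degree R d n) =
  ((\sum_(0 <= k < n) 'C(k + d - 1, d - 1))%N%:R)%:E.
Proof.
move=> d0; rewrite -card_sorted_word//.
apply: (@dimension_dual_basis _ _ _ _ (fun i : sorted_word n => monomial (word i))
  (fun i => coefficient (word i))) => [i k nk|i j|x].
- by apply: monomial_components0; rewrite ltn_eqF// (leq_trans (size_word i)).
- by rewrite /= coefficient_monomial perm_eq_word eq_sym.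
- exact: low_degree_monomials.
Qed.
End Monomials.

Theorem lemma4p3 (R : realType) (d : nat) (d_gt0 : (0 < d)%N)
    (e : 'I_d -> 'rV[R[i]]_d) (e_onb : orthonormal_basis e) :
  maximal_commuting_tuple (d_shift e).
Proof.
split=> [||n _]; first exact: d_shift_commuting.
  exact: d_shift_contractive.
rewrite /defect_dimension !closure_defect_range// !dimension_low_degree//.
by rewrite [X in (_ * (X%:R)%:E)%E]big_nat1 add0n binn mule1.
Qed.
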